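(* Let $X\subset\mathbb R^n$ be a nonempty polyhedral convex set, let $f=(f_1,\dots,f_m)^T:X\to\mathbb R^m$ have affine components $f_i$, let $K\subset\mathbb R^m$ be a pointed polyhedral convex cone, and let $e\in K\setminus\{0\}$. Consider the linear vector optimization problem (VP) of minimizing $f(x)$ subject to $x\in X$ with respect to the ordering cone $K$. Then either the set $E^{Be}_e$ of $e$-properly efficient solutions of (VP) is empty, or $E^{Be}_e=E_e$, where $E_e$ is the set of $e$-efficient solutions of (VP).
   Context: A nonempty set $C\subset\mathbb R^m$ is a cone if $tv\in C$ for all $v\in C$ and $t\ge 0$. A cone $K$ is pointed if $K\cap(-K)=\{0\}$. For a nonempty set $D\subset\mathbb R^m$, ${\rm cone}\,D$ is the smallest cone containing $D$, i.e. $\{td: t\ge0,\ d\in D\}$, and $\overline{\rm cone}\,D$ is its topological closure. A polyhedral convex set is a finite intersection of closed half-spaces (the whole space being allowed); a polyhedral convex cone is a polyhedral convex set that is a cone. For $y^1,y^2\in\mathbb R^m$, $y^1\le_K y^2$ means $y^2-y^1\in K$. A point $x\in X$ is an $e$-efficient solution of (VP) if there is no $y\in X$ such that $f(y)\le_K f(x)-e$ and $f(y)\ne f(x)-e$. The set of these points is $E_e$. A point $\bar x\in X$ is an $e$-properly efficient solution of (VP) if $$\overline{\rm cone}\big[f(X)+K-(f(\bar x)-e)\big]\cap(-K)=\{0\}.$$ The set of these points is $E^{Be}_e$. *)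

(* Defs.v *)
From HB Require Import structures.
From mathcomp Require Import all_boot all_order all_algebra.
From mathcomp Require Import all_classical all_reals.
From mathcomp Require Import topology normedtype.

Set Implicit Arguments.
Unset Strict Implicit.
Unset Printing Implicit Defensive.

Import Order.TTheory GRing.Theory Num.Theory.
Import numFieldNormedType.Exports.

Local Open Scope classical_set_scope.
Local Open Scope ring_scope.

Definition dotv (R : realType) (n : nat) (a x : 'cV[R]_n) : R :=
  \sum_(i < n) a i 0 * x i 0.

Definition closed_halfspace (R : realType) (n : nat) (H : set 'cV[R]_n) : Prop :=
  exists (a : 'cV[R]_n) (b : R), a != 0 /\ H = [set x | dotv a x <= b].

(* [p = 0] gives the whole space. *)
Definition polyhedral (R : realType) (n : nat) (X : set 'cV[R]_n) : Prop :=
  exists (p : nat) (H : 'I_p -> set 'cV[R]_n),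
    (forall i, closed_halfspace (H i)) /\ X = \bigcap_(i in [set: 'I_p]) H i.

Definition is_cone (R : realType) (m : nat) (C : set 'cV[R]_m) : Prop :=
  C !=set0 /\ forall v t, C v -> 0 <= t -> C (t *: v).

Definition opp_set (R : realType) (m : nat) (K : set 'cV[R]_m) : set 'cV[R]_m :=
  [set - k | k in K].

Definition pointed (R : realType) (m : nat) (K : set 'cV[R]_m) : Prop :=
  K `&` opp_set K = [set 0].

Definition polyhedral_cone (R : realType) (m : nat) (K : set 'cV[R]_m) : Prop :=
  polyhedral K /\ is_cone K.

Definition cone_hull (R : realType) (m : nat) (D : set 'cV[R]_m) : set 'cV[R]_m :=
  [set v | exists t d, [/\ 0 <= t, D d & v = t *: d]].

Definition le_cone (R : realType) (m : nat) (K : set 'cV[R]_m)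
    (y1 y2 : 'cV[R]_m) : Prop := K (y2 - y1).

(* A map X -> R^m is represented by a total function, of which only the values
   on X are used. *)
Definition affine_components (R : realType) (n m : nat) (X : set 'cV[R]_n)
    (f : 'cV[R]_n -> 'cV[R]_m) : Prop :=
  forall i : 'I_m, exists (c : 'cV[R]_n) (alpha : R),
    forall x, X x -> f x i 0 = dotv c x + alpha.

Definition e_efficient (R : realType) (n m : nat) (X : set 'cV[R]_n)
    (f : 'cV[R]_n -> 'cV[R]_m) (K : set 'cV[R]_m) (e : 'cV[R]_m) :
    set 'cV[R]_n :=
  [set x | X x /\
    ~ exists y, [/\ X y, le_cone K (f y) (f x - e) & f y <> f x - e]].

(* The set f(X) + K - p. *)
Definition shifted_image (R : realType) (n m : nat) (X : set 'cV[R]_n)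
    (f : 'cV[R]_n -> 'cV[R]_m) (K : set 'cV[R]_m) (p : 'cV[R]_m) :
    set 'cV[R]_m :=
  [set v | exists x k, [/\ X x, K k & v = f x + k - p]].

Definition e_properly_efficient (R : realType) (n m : nat) (X : set 'cV[R]_n)
    (f : 'cV[R]_n -> 'cV[R]_m) (K : set 'cV[R]_m) (e : 'cV[R]_m) :
    set 'cV[R]_n :=
  [set x | X x /\
    closure (cone_hull (shifted_image X f K (f x - e))) `&` opp_set K
      = [set 0]].

(* Main.v *)
(* Write Q_x = f(X) + K - (f(x) - e), a polyhedron.  Homogenising its linear
   description, and using that linear images of polyhedra are closed
   (Fourier-Motzkin elimination), every w in the closure of cone Q_x is either a
   multiple of a point of Q_x or a recession direction of Q_x.  The recession
   directions are the same for all x, and lie in the closure of cone Q_x; hence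
   one properly efficient point excludes those in -K for all x at once, while
   e-efficiency of x together with pointedness of K excludes the multiples. *)
Require Import Defs.
From mathcomp Require Import all_boot all_order all_algebra.
From mathcomp Require Import all_classical all_reals.
From mathcomp Require Import topology normedtype.
From mathcomp Require Import ring lra.

Set Implicit Arguments.
Unset Strict Implicit.
Unset Printing Implicit Defensive.

Import Order.TTheory GRing.Theory Num.Theory.
Import numFieldNormedType.Exports.

Local Open Scope classical_set_scope.
Local Open Scope ring_scope.

(** * Elimination of variables and closedness of projections *)

(* Nonnegative weights cancelling the variable t between the i-th and j-th of
   the inequalities a i * t <= b i: they combine an upper with a lower bound on
   t; when a i = 0 they keep inequality i; otherwise they give 0 <= 0. *)
Definition elim_wl {R : realType} {I : Type} (a : I -> R) (i j : I) : R :=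
  if (0 < a i) && (a j < 0) then - a j else (a i == 0)%:R.

Definition elim_wr {R : realType} {I : Type} (a : I -> R) (i j : I) : R :=
  if (0 < a i) && (a j < 0) then a i else 0.

Lemma elim_wl_ge0 (R : realType) (I : Type) (a : I -> R) (i j : I) :
  0 <= elim_wl a i j.
Proof. by rewrite /elim_wl; case: ifP => [/andP[_ /ltW]|_]; rewrite ?oppr_ge0. Qed.

Lemma elim_wr_ge0 (R : realType) (I : Type) (a : I -> R) (i j : I) :
  0 <= elim_wr a i j.
Proof. by rewrite /elim_wr; case: ifP => [/andP[/ltW]|]. Qed.

Lemma elim_w_cancel (R : realType) (I : Type) (a : I -> R) (i j : I) :
  elim_wl a i j * a i + elim_wr a i j * a j = 0.
Proof.
rewrite /elim_wl /elim_wr; case: ifP => _; first by rewrite mulNr mulrC addNr.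
by have [->|_] := eqVneq (a i) 0; rewrite !(mulr0, mul0r, addr0).
Qed.

(** Positive [a i] bound [t] above by [b i / a i], negative [a j] bound it below by [b j / a j], and
    the pairwise conditions put every lower bound under every upper one. The largest lower bound
    then works; without lower bounds the smallest upper bound, and without any bound 0. *)
Lemma fourier_motzkin (R : realType) (I : finType) (a b : I -> R) :
  (exists t, forall i, a i * t <= b i) <->
  (forall i j, 0 <= elim_wl a i j * b i + elim_wr a i j * b j).
Proof.
split=> [[t tP] i j|bP].
  rewrite -[leLHS](mul0r t) -(elim_w_cancel a i j) mulrDl -!mulrA.
  by apply: lerD; apply: ler_wpM2l; rewrite ?elim_wl_ge0 ?elim_wr_ge0.
have cross i j : 0 < a i -> a j < 0 -> b j / a j <= b i / a i.
  move=> ai aj; have := bP i j; rewrite /elim_wl /elim_wr ai aj /= => h.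
  rewrite ler_pdivlMr// mulrAC ler_ndivrMr//; lra.
have zero i : a i = 0 -> 0 <= b i.
  move=> ai; have := bP i i.
  by rewrite /elim_wl /elim_wr ai ltxx eqxx /= mul1r mul0r addr0.
have bound t : (forall i, 0 < a i -> t <= b i / a i) ->
    (forall j, a j < 0 -> b j / a j <= t) -> exists t, forall i, a i * t <= b i.
  move=> up lo; exists t => i; case: (ltgtP (a i) 0) => ai.
  - by rewrite mulrC -ler_ndivrMr//; exact: lo.
  - by rewrite mulrC -ler_pdivlMr//; exact: up.
  - by rewrite ai mul0r; exact: zero.
case: (pickP (fun j => a j < 0)) => [j0 j0N|noN].
  case: (@arg_maxP _ _ _ j0 (fun j => a j < 0) (fun j => b j / a j) j0N) => j jN jmax.
  apply: (bound (b j / a j)) => [i ai|k ak]; first exact: cross.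
  exact: jmax.
case: (pickP (fun j => 0 < a j)) => [j0 j0P|noP].
  case: (@arg_minP _ _ _ j0 (fun j => 0 < a j) (fun j => b j / a j) j0P) => j jN jmin.
  apply: (bound (b j / a j)) => [i ai|k]; first exact: jmin.
  by rewrite noN.
by apply: (bound 0) => i; rewrite ?noP ?noN.
Qed.

Lemma mul_row_col_scalarE (R : realType) (k : nat) (u : 'rV[R]_1)
    (v : 'rV[R]_k) (t : R) (x : 'cV[R]_k) :
  (row_mx u v *m col_mx t%:M x) 0 0 = u 0 0 * t + (v *m x) 0 0.
Proof. by rewrite mul_row_col mxE mul_mx_scalar mxE mulrC. Qed.

(** Induction on the number of unknowns: eliminating the first coordinate of [z] leaves a system
    indexed by [I * I] whose right-hand sides are combinations of the [g i], hence still continuous.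
    With no unknowns left, the set is a finite intersection of preimages of the closed half-line. *)
Lemma closed_linear_system (R : realType) (T : topologicalType) (k : nat)
    (I : finType) (A : I -> 'rV[R]_k) (g : I -> T -> R) :
  (forall i, continuous (g i)) ->
  closed [set w | exists z : 'cV[R]_k, forall i, (A i *m z) 0 0 <= g i w].
Proof.
elim: k I A g => [|k IH] I A g gC.
  rewrite [X in closed X](_ : _ = \bigcap_(i in [set: I]) (g i @^-1` [set r | 0 <= r])).
    apply: closed_bigI => i _; apply: preimage_closed => [w _|]; first exact: gC.
    exact: closed_ge.
  apply/seteqP; split=> w /=.
    by case=> z zP i _ /=; have := zP i; rewrite thinmx0 mul0mx mxE.
  by move=> wP; exists 0 => i; rewrite mulmx0 mxE; exact: wP.
pose a i := @lsubmx R 1 1 k (A i) 0 0.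
pose B i := @rsubmx R 1 1 k (A i).
pose B' (ij : I * I) :=
  elim_wl a ij.1 ij.2 *: B ij.1 + elim_wr a ij.1 ij.2 *: B ij.2.
pose g' (ij : I * I) w :=
  elim_wl a ij.1 ij.2 * g ij.1 w + elim_wr a ij.1 ij.2 * g ij.2 w.
have g'C ij : continuous (g' ij).
  by move=> w; apply: cvgD; apply: cvgM; [exact: cvg_cst|exact: gC|
    exact: cvg_cst|exact: gC].
have AE i (t : R) (x : 'cV_k) :
    (A i *m (col_mx (t%:M : 'cV_1) x : 'cV_k.+1)) 0 0 = a i * t + (B i *m x) 0 0.
  by rewrite -[A i](@hsubmxK R 1 1 k) mul_row_col_scalarE.
have FM w (x : 'cV_k) : (exists t, forall i, a i * t <= g i w - (B i *m x) 0 0) <->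
    (forall ij, (B' ij *m x) 0 0 <= g' ij w).
  rewrite fourier_motzkin; split=> [h [i j]|h i j].
    have := h i j; rewrite /g' /B' /= mulmxDl -!scalemxAl !mxE; lra.
  have := h (i, j); rewrite /g' /B' /= mulmxDl -!scalemxAl !mxE; lra.
rewrite [X in closed X](_ : _ =
  [set w | exists x : 'cV[R]_k, forall ij, (B' ij *m x) 0 0 <= g' ij w]).
  exact: IH.
apply/seteqP; split=> w /=.
  case=> z zP; exists (@dsubmx R 1 k 1 z); apply/FM.
  exists (@usubmx R 1 k 1 z 0 0) => i; rewrite lerBrDr -AE.
  by rewrite -mx11_scalar vsubmxK; exact: zP.
case=> x /FM[t tP]; exists (col_mx (t%:M : 'cV_1) x) => i.
by rewrite AE -lerBrDr.
Qed.

(** * Linear forms, polyhedra and affine maps *)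

Lemma dotvE (R : realType) (n : nat) (a x : 'cV[R]_n) :
  dotv a x = (a^T *m x) 0 0.
Proof. by rewrite /dotv mxE; apply: eq_bigr => i _; rewrite mxE. Qed.

Lemma dotvZr (R : realType) (n : nat) (a x : 'cV[R]_n) (t : R) :
  dotv a (t *: x) = t * dotv a x.
Proof. by rewrite !dotvE -scalemxAr mxE. Qed.

Lemma dotvDr (R : realType) (n : nat) (a x y : 'cV[R]_n) :
  dotv a (x + y) = dotv a x + dotv a y.
Proof. by rewrite !dotvE mulmxDr mxE. Qed.

Lemma continuous_dotv (R : realType) (n : nat) (a : 'cV[R]_n) :
  continuous (dotv a).
Proof.
move=> x; apply: (@cvg_big R _ +%R 0 xpredT _ _ (nbhs x)) => [z|i _].
  exact: add_continuous.
by apply: cvgM; [exact: cvg_cst|exact: coord_continuous].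
Qed.

Lemma polyhedral_ineqs (R : realType) (n : nat) (X : set 'cV[R]_n) :
  polyhedral X -> exists (p : nat) (a : 'I_p -> 'cV[R]_n) (b : 'I_p -> R),
    forall x, X x <-> forall i, dotv (a i) x <= b i.
Proof.
case=> p [H [Hhalf ->]].
have /choice[ab abP] : forall i, exists ab : 'cV[R]_n * R,
    H i = [set x | dotv ab.1 x <= ab.2].
  by move=> i; have [a [b [_ ->]]] := Hhalf i; exists (a, b).
exists p, (fun i => (ab i).1), (fun i => (ab i).2) => x; split=> xP i.
  by have := xP i Logic.I; rewrite abP.
by move=> _; rewrite abP; exact: xP.
Qed.

Lemma polyhedral_cone0 (R : realType) (m : nat) (K : set 'cV[R]_m) :
  polyhedral_cone K -> K 0.
Proof. by move=> [_ [[v Kv] KZ]]; rewrite -(scale0r v); exact: KZ. Qed.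

Lemma polyhedral_coneD (R : realType) (m : nat) (K : set 'cV[R]_m) u v :
  polyhedral_cone K -> K u -> K v -> K (u + v).
Proof.
move=> [/polyhedral_ineqs[p [a [b Kab]]] [_ KZ]] Ku Kv.
(* [u + v] is the midpoint of [2 *: u] and [2 *: v], so averaging their inequalities suffices. *)
have /Kab Ku2 := KZ u 2 Ku ltac:(lra).
have /Kab Kv2 := KZ v 2 Kv ltac:(lra).
apply/Kab => i; have := Ku2 i; have := Kv2 i.
rewrite !dotvZr dotvDr; lra.
Qed.

Lemma affine_components_mx (R : realType) (n m : nat) (X : set 'cV[R]_n)
    (f : 'cV[R]_n -> 'cV[R]_m) :
  affine_components X f ->
  exists (L : 'M[R]_(m, n)) (c : 'cV[R]_m), forall x, X x -> f x = L *m x + c.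
Proof.
move=> fA; have /choice[ca caP] : forall i, exists ca : 'cV[R]_n * R,
    forall x, X x -> f x i 0 = dotv ca.1 x + ca.2.
  by move=> i; have [c [al h]] := fA i; exists (c, al).
exists (\matrix_(i, j) (ca i).1 j 0), (\col_i (ca i).2) => x Xx.
apply/colP => i; rewrite caP// !mxE; congr (_ + _).
by apply: eq_bigr => j _; rewrite mxE.
Qed.

(** * Closure of the generated cone *)

Lemma closure_ray (R : realType) (m : nat) (S : set 'cV[R]_m) (w v : 'cV[R]_m) :
  (forall r, 0 < r -> S (w + r *: v)) -> closure S w.
Proof.
move=> wS B wB.
have cvgw : (w + r *: v) @[r --> (0:R)^'+] --> w.
  rewrite -[X in _ --> X]addr0 -(scale0r v).
  apply: cvgD; first exact: cvg_cst.
  by apply: cvgZr_tmp; exact: cvg_at_right_filter cvg_id.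
have : \forall r \near (0:R)^'+, S (w + r *: v) /\ B (w + r *: v).
  near=> r; split; last by near: r; exact: cvgw.
  by apply: wS; near: r; exact: nbhs_right_gt.
by case/filter_ex => r [Sr Br]; exists (w + r *: v).
Unshelve. all: by end_near. Qed.

(* The second alternative is the case of a recession direction of f(X) + K,
   which is why it does not depend on the shift p. *)
Lemma closure_cone_shifted_image (R : realType) (n m : nat)
    (X : set 'cV[R]_n) (f : 'cV[R]_n -> 'cV[R]_m) (K : set 'cV[R]_m)
    (p w : 'cV[R]_m) :
  X !=set0 -> polyhedral X -> affine_components X f -> polyhedral_cone K ->
  closure (cone_hull (shifted_image X f K p)) w ->
  cone_hull (shifted_image X f K p) w \/
  forall p', closure (cone_hull (shifted_image X f K p')) w.
Proof.
move=> [x0 Xx0] /polyhedral_ineqs[q [a [b XE]]] /affine_components_mx[L [c fE]].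
move=> Kpc; have [Kpoly [_ KZ]] := Kpc.
have [s [a' [b' KE]]] := polyhedral_ineqs Kpoly.
(* With t = 1 the conditions defining P say that x is in X and w in L x + c + K - p. *)
pose P := [set w | exists t x, [/\ 0 <= t, forall i, dotv (a i) x <= t * b i &
  K (w - (L *m x + t *: (c - p)))]].
have Pclosed : closed P.
  (* Rows acting on the stacked unknown [(t, x)]: [None] encodes [0 <= t], [inl] the homogenised
     inequalities of [X], [inr] those of [K], the only ones whose right-hand side involves [w]. *)
  pose A (i : option ('I_q + 'I_s)) : 'rV[R]_(1 + n) := match i with
    | None => row_mx (-1)%:M 0
    | Some (inl i) => row_mx (- b i)%:M (a i)^T
    | Some (inr i) => row_mx ((a' i)^T *m (p - c)) ((a' i)^T *m - L) end.
  pose g (i : option ('I_q + 'I_s)) w := match i with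
    | Some (inr i) => b' i - dotv (a' i) w
    | _ => 0 end.
  have gC i : continuous (g i).
    case: i => [[i|i]|] u; try exact: cst_continuous.
    exact: (cvgB (cvg_cst _) (@continuous_dotv _ _ (a' i) u)).
  have := @closed_linear_system _ _ _ _ A g gC.
  have AgP t x u : (forall i, (A i *m col_mx t%:M x) 0 0 <= g i u) <->
      [/\ 0 <= t, forall i, dotv (a i) x <= t * b i &
        K (u - (L *m x + t *: (c - p)))].
    have -> : u - (L *m x + t *: (c - p)) = u + (- L *m x + t *: (p - c)).
      by rewrite mulNmx opprD -scalerN opprB.
    split=> [h|[t0 hX /KE hK]].
      split=> [|i|]; last apply/KE => i.
      - have := h None.
        rewrite /= mul_row_col_scalarE mul0mx !mxE mulr1n; lra.
      - have := h (Some (inl i)).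
        rewrite /= mul_row_col_scalarE -dotvE mxE mulr1n; lra.
      - have := h (Some (inr i)).
        rewrite /= mul_row_col_scalarE -mulmxA -!dotvE (dotvDr _ u) (dotvDr _ _ (t *: _)) dotvZr; lra.
    case=> [[i|i]|] /=; rewrite mul_row_col_scalarE.
    - rewrite -dotvE mxE mulr1n; have := hX i; lra.
    - have := hK i; rewrite -mulmxA -!dotvE (dotvDr _ u) (dotvDr _ _ (t *: _)) dotvZr; lra.
    - rewrite mul0mx !mxE mulr1n; lra.
  congr closed; apply/seteqP; split=> u /=.
    case=> z; rewrite -[z]vsubmxK [usubmx z]mx11_scalar => /AgP h.
    by eexists; eexists; exact: h.
  by case=> t [x /AgP h]; exists (col_mx t%:M x).
have cone_sub : cone_hull (shifted_image X f K p) `<=` P.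
  move=> _ [t [_ [t0 [x [k [Xx Kk ->]]] ->]]]; exists t, (t *: x); split=> //.
    by move=> i; rewrite dotvZr ler_wpM2l//; exact: (XE x).1.
  rewrite fE// -scalemxAr -scalerDr -scalerBr.
  suff -> : L *m x + c + k - p - (L *m x + (c - p)) = k by exact: KZ.
  by apply/colP => i; rewrite !mxE; lra.
move=> /(closureS cone_sub); rewrite -(closure_id _).1// => -[t [x [t0 xP Kw]]].
have [tE|tN] := eqVneq t 0; [right => p'|left].
  (* Here [x] is a recession direction of [X] and [w - L *m x] lies in [K]. Moving from [x0] by
     [r^-1 *: x] and adding [r^-1 *: (w - L *m x)] gives a point of the shifted image whose multiple
     by [r] is [w + r *: (f x0 - p')]. *)
  rewrite {t t0}tE scale0r addr0 in xP Kw.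
  apply: (@closure_ray _ _ _ w (f x0 - p')) => r r0.
  have Xr : X (x0 + r^-1 *: x).
    apply/XE => i; rewrite dotvDr dotvZr.
    have := (XE x0).1 Xx0 i; have := xP i; rewrite mul0r => h1 h2.
    have h3 : r^-1 * dotv (a i) x <= 0 by rewrite pmulr_rle0 ?invr_gt0.
    lra.
  exists r, (f (x0 + r^-1 *: x) + r^-1 *: (w - L *m x) - p'); split.
  - exact: ltW.
  - by exists (x0 + r^-1 *: x), (r^-1 *: (w - L *m x)); split=> //;
      apply: (KZ _ _ Kw); rewrite invr_ge0 ltW.
  - rewrite !fE// mulmxDr -scalemxAr.
    by apply/colP => i; rewrite !mxE; field; rewrite gt_eqF.
have {tN}t_gt0 : 0 < t by rewrite lt_neqAle eq_sym tN.
have tV : 0 < t^-1 by rewrite invr_gt0.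
have Xt : X (t^-1 *: x).
  by apply/XE => i; rewrite dotvZr mulrC ler_pdivrMr// mulrC.
exists t, (t^-1 *: w); split=> //; last by rewrite scalerA divff ?gt_eqF ?scale1r.
exists (t^-1 *: x), (t^-1 *: (w - (L *m x + t *: (c - p)))); split=> //.
  by apply: KZ => //; exact: ltW.
rewrite fE// -scalemxAr scalerBr scalerDr scalerA mulVf ?gt_eqF// scale1r.
by apply/colP => i; rewrite !mxE; lra.
Qed.

Theorem theorem5p4 (R : realType) (n m : nat)
    (X : set 'cV[R]_n) (f : 'cV[R]_n -> 'cV[R]_m)
    (K : set 'cV[R]_m) (e : 'cV[R]_m)
    (X_nonempty : X !=set0) (X_polyhedral : polyhedral X)
    (f_affine : affine_components X f)
    (K_cone : polyhedral_cone K) (K_pointed : pointed K)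
    (eK : K e) (e_neq0 : e <> 0) :
  e_properly_efficient X f K e = set0 \/
  e_properly_efficient X f K e = e_efficient X f K e.
Proof.
have K0 := polyhedral_cone0 K_cone; have KZ := K_cone.2.2.
have [->|/set0P[xb [Xxb xbE]]] := eqVneq (e_properly_efficient X f K e) set0.
  by left.
right; apply/seteqP; split=> x [Xx xE]; split=> //.
  (* The difference [f y - (f x - e)] lies both in the cone (take [t = 1], [k = 0]) and in [-K]. *)
  case=> y [Xy yK yN]; apply: yN; apply/subr0_eq.
  suff : [set 0] (f y - (f x - e)) by [].
  rewrite -xE; split; last by exists (f x - e - f y); rewrite ?opprB.
  apply: subset_closure; exists 1, (f y - (f x - e)); split; rewrite ?scale1r//.
  by exists y, 0; rewrite addr0.
apply/seteqP; split=> [w [wC wK]|_ ->]; last first.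
  split; last by exists 0; rewrite ?oppr0.
  apply: subset_closure; exists 0, (f x + 0 - (f x - e)); split => //.
    by exists x, 0.
  by rewrite scale0r.
have [[t [_ [t0 [y [k [Xy Kk ->]]] wE]]]|wC'] :=
    closure_cone_shifted_image X_nonempty X_polyhedral f_affine K_cone wC; last first.
  (* The recession alternative at the shift [f xb - e] contradicts proper efficiency of [xb] unless
     [w = 0]. *)
  by rewrite -xbE; split.
have [tE|tN] := eqVneq t 0; first by rewrite wE tE scale0r.
have [k' Kk' k'E] := wK.
have yxE : f x - e - f y = k + t^-1 *: k'.
  have -> : k' = - (t *: (f y + k - (f x - e))) by rewrite -wE -k'E opprK.
  rewrite scalerN scalerA mulVf// scale1r.
  by apply/colP => i; rewrite !mxE; lra.
have Kt : K (t^-1 *: k') by apply: KZ; rewrite // invr_ge0.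
(* Since [f x - e - f y] is in [K], e-efficiency of [x] forces [f y = f x - e]; then [k] lies in
   both [K] and [-K], so [k = 0] and [w = 0]. *)
have [fyE|fyN] := pselect (f y = f x - e); last first.
  case: xE; exists y; split=> //.
  by rewrite /le_cone yxE; exact: polyhedral_coneD.
have kE : k = - (t^-1 *: k').
  by apply/eqP; rewrite -addr_eq0 -yxE fyE subrr.
have k0 : [set 0] k by rewrite -K_pointed; split=> //; exists (t^-1 *: k').
by rewrite wE fyE k0 addr0 subrr scaler0.
Qed.
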